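(* Let $A\in\mathbb{R}^{n\times n}$ be invertible, $B\in\mathbb{R}^{n\times n}$ symmetric positive definite, $S\in\mathbb{R}^{n\times q}$ and $X_k\in\mathbb{R}^{n\times n}$. (Row variant) The problems $$X_{k+1}=\arg\min_{X\in\mathbb{R}^{n\times n}}\tfrac12\|X-X_k\|_{F(B)}^2\quad\text{subject to}\quad S^\top AX=S^\top$$ and $$X_{k+1}=\arg_X\min_{X\in\mathbb{R}^{n\times n},\,Y\in\mathbb{R}^{n\times q}}\tfrac12\|X-A^{-1}\|_{F(B)}^2\quad\text{subject to}\quad X=X_k+B^{-1}A^\top SY^\top$$ are equivalent, i.e. they define the same matrix $X_{k+1}$. If $S$ has full column rank, then $$X_{k+1}=X_k+B^{-1}A^\top S(S^\top AB^{-1}A^\top S)^{-1}S^\top(I-AX_k).$$ (Column variant) The problems $$X_{k+1}=\arg\min_{X\in\mathbb{R}^{n\times n}}\tfrac12\|X-X_k\|_{F(B)}^2\quad\text{subject to}\quad XAS=S$$ and $$X_{k+1}=\arg_X\min_{X\in\mathbb{R}^{n\times n},\,Y\in\mathbb{R}^{n\times q}}\tfrac12\|X-A^{-1}\|_{F(B)}^2\quad\text{subject to}\quad X=X_k+YS^\top A^\top B^{-1}$$ are equivalent, i.e. they define the same matrix $X_{k+1}$. If $S$ has full column rank, then $$X_{k+1}=X_k+(I-X_kA)S(S^\top A^\top B^{-1}AS)^{-1}S^\top A^\top B^{-1}.$$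
   Context: $\|X\|_{F(B)}^2=\mathrm{Tr}(X^\top BXB)=\|B^{1/2}XB^{1/2}\|_F^2$ is the weighted Frobenius norm. $\arg_X\min_{X,Y}$ means the $X$-component of a minimizer $(X,Y)$. *)

(* Defs.v *)
From HB Require Import structures.
From mathcomp Require Import all_boot all_order all_algebra.
From mathcomp Require Import reals.

Set Implicit Arguments.
Unset Strict Implicit.
Unset Printing Implicit Defensive.

Import Order.TTheory GRing.Theory Num.Theory.
Local Open Scope ring_scope.

Definition sym_posdef (R : realType) (n : nat) (B : 'M[R]_n) : Prop :=
  B^T = B /\ forall x : 'cV[R]_n, x != 0 -> 0 < (x^T *m B *m x) 0 0.

(* The square of the weighted Frobenius norm ||X||_{F(B)}. *)
Definition sqnormFB (R : realType) (n : nat) (B X : 'M[R]_n) : R :=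
  \tr (X^T *m B *m X *m B).

(* Agreement with ||B^{1/2} X B^{1/2}||_F^2, for C a symmetric square root
   of B. *)
Lemma sqnormFB_sqrt (R : realType) (n : nat) (B C X : 'M[R]_n) :
  C^T = C -> C *m C = B ->
  sqnormFB B X = \sum_i \sum_j ((C *m X *m C) i j) ^+ 2.
Proof.
move=> symC <-; rewrite /sqnormFB !mulmxA mxtrace_mulC !mulmxA.
transitivity (\tr ((C *m X *m C)^T *m (C *m X *m C))).
  by rewrite !trmx_mul symC !mulmxA.
rewrite /mxtrace exchange_big; apply: eq_bigr => j _.
by rewrite mxE; apply: eq_bigr => i _; rewrite mxE expr2.
Qed.

Definition is_argmin (R : realType) (T : Type)
    (feasible : T -> Prop) (f : T -> R) (x : T) : Prop :=
  feasible x /\ forall y : T, feasible y -> f x <= f y.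

(* X is the first component of some minimizer (X, Y); Y need not be unique. *)
Definition is_argmin_fst (R : realType) (T U : Type)
    (feasible : T * U -> Prop) (f : T * U -> R) (x : T) : Prop :=
  exists y : U, is_argmin feasible f (x, y).

(* Main.v *)
(* For the inner product <X, Y> = tr (X^T B Y B), the directions of the affine
   spaces {X | S^T A X = S^T}, which contains A^-1, and
   {Xk + B^-1 A^T S Y^T}, which contains Xk, are orthogonal.  Any common point
   is therefore, by Pythagoras, both the projection of Xk on the first space
   and that of A^-1 on the second.  A common point exists even for rank
   deficient S, because the Gram matrix M^T B^-1 M has the same row space as
   M = A^T S.  The column variant is the transpose of the row variant for A^T
   and Xk^T. *)
Require Import Defs.
From HB Require Import structures.
From mathcomp Require Import all_boot all_order all_algebra.
From mathcomp Require Import reals.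

Set Implicit Arguments.
Unset Strict Implicit.
Unset Printing Implicit Defensive.

Import Order.TTheory GRing.Theory Num.Theory.
Local Open Scope ring_scope.

(** * Definiteness of the unweighted Frobenius form *)

Lemma mxtrace_trmx_mul (R : pzRingType) (m p : nat) (W : 'M[R]_(m, p)) :
  \tr (W^T *m W) = \sum_j \sum_i W i j * W i j.
Proof.
apply: eq_bigr => j _; rewrite mxE.
by apply: eq_bigr => i _; rewrite mxE.
Qed.

Lemma mxtrace_trmx_mul_ge0 (R : realDomainType) (m p : nat)
    (W : 'M[R]_(m, p)) : 0 <= \tr (W^T *m W).
Proof.
rewrite mxtrace_trmx_mul; apply: sumr_ge0 => j _; apply: sumr_ge0 => i _.
by rewrite -expr2 sqr_ge0.
Qed.

Lemma mxtrace_trmx_mul_eq0 (R : realDomainType) (m p : nat)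
    (W : 'M[R]_(m, p)) : \tr (W^T *m W) = 0 -> W = 0.
Proof.
have sq_ge0 i j : 0 <= W i j * W i j by rewrite -expr2 sqr_ge0.
rewrite mxtrace_trmx_mul => /eqP.
rewrite psumr_eq0 => [/allP W0|j _]; last by rewrite sumr_ge0.
apply/matrixP => i j; rewrite mxE.
have /= := W0 j (mem_index_enum j); rewrite psumr_eq0 // => /allP Wj0.
by have /= := Wj0 i (mem_index_enum i); rewrite mulf_eq0 orbb => /eqP.
Qed.

(** Cholesky factorization, by induction on the size: the Schur complement of the top left entry is
    again symmetric positive definite. The factor [C] takes the place of the square root of [B]. *)
Lemma sym_posdef_factor (R : realType) (n : nat) (B : 'M[R]_n) :
  sym_posdef B -> exists2 C : 'M[R]_n, C \in unitmx & B = C^T *m C.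
Proof.
elim: n B => [|n IHn] B [symB posB].
  by exists 1%:M; [exact: unitmx1 | rewrite flatmx0 [RHS]flatmx0].
pose a := (B : 'M_(1 + n)) 0 0.
pose b : 'rV[R]_n := ursubmx (B : 'M_(1 + n)).
pose D : 'M[R]_n := drsubmx (B : 'M_(1 + n)).
have defB : B = block_mx a%:M b b^T D :> 'M_(1 + n).
  rewrite -[LHS](@submxK _ 1 n 1 n) /b trmx_ursub symB; congr block_mx.
  by rewrite [LHS]mx11_scalar !mxE lshift0.
have symD : D^T = D by rewrite /D trmx_drsub symB.
clearbody a b D; subst B => {symB}.
have quad (t : 'M[R]_1) (y : 'cV[R]_n) :
    (col_mx t y)^T *m block_mx a%:M b b^T D *m col_mx t y
    = a *: (t^T *m t) + t^T *m (b *m y) + (b *m y)^T *m t + y^T *m D *m y.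
  rewrite tr_col_mx mul_row_block mul_row_col !mulmxDl mul_mx_scalar -scalemxAl.
  by rewrite trmx_mul !mulmxA addrACA !addrA.
have a_gt0 : 0 < a.
  have nz : col_mx 1%:M (0 : 'cV[R]_n) != 0 :> 'cV[R]_(1 + n).
    apply/eqP => /(congr1 usubmx); rewrite col_mxKu linear0 => /matrixP/(_ 0 0).
    by rewrite !mxE eqxx => /eqP; rewrite oner_eq0.
  have := posB _ nz; rewrite quad !mulmx0 trmx0 !mul0mx !addr0 trmx1 mulmx1.
  by rewrite !mxE eqxx mulr1.
have [|C unitC defC] := IHn (D - a^-1 *: (b^T *m b)).
  split=> [|y nzy].
    by rewrite linearB linearZ /= symD trmx_mul trmxK.
  (* Minimizing the quadratic form over its first coordinate. *)
  pose t : 'M[R]_1 := - (a^-1 *: (b *m y)).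
  have nz : col_mx t y != 0 :> 'cV[R]_(1 + n).
    apply: contra nzy => /eqP/(congr1 dsubmx).
    by rewrite col_mxKd linear0 => /eqP.
  have := posB _ nz; rewrite quad /t.
  set w := b *m y.
  have -> : y^T *m (D - a^-1 *: (b^T *m b)) *m y
            = y^T *m D *m y - a^-1 *: (w^T *m w).
    rewrite mulmxBr mulmxBl -scalemxAr -scalemxAl /w trmx_mul.
    by rewrite !mulmxA.
  have -> : (- (a^-1 *: w))^T = - (a^-1 *: w^T) by rewrite linearN linearZ.
  rewrite !mulNmx !mulmxN opprK -!scalemxAl -!scalemxAr.
  rewrite scalerA mulfV ?gt_eqF // scale1r addrN add0r.
  by rewrite addrC.
pose s := Num.sqrt a.
have s_neq0 : s != 0 by rewrite gt_eqF // sqrtr_gt0.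
have ss : s * s = a by rewrite -expr2 sqr_sqrtr // ltW.
(* The first row reproduces [a] and [b] and contributes [a^-1 *: (b^T *m b)] to the lower block,
   just what the Schur complement subtracted. *)
pose C1 : 'M[R]_(1 + n) := block_mx s%:M (s^-1 *: b) 0 C.
exists C1.
  rewrite unitmxE [\det _](@det_ublock _ 1 n) det_scalar1 unitrM -unitmxE unitC.
  by rewrite andbT unitfE.
change (block_mx a%:M b b^T D = C1^T *m C1).
rewrite /C1 tr_block_mx mulmx_block; congr block_mx.
- by rewrite trmx0 mul0mx addr0 tr_scalar_mx -scalar_mxM ss.
- rewrite trmx0 mul0mx addr0 tr_scalar_mx mul_scalar_mx scalerA mulfV //.
  by rewrite scale1r.
- by rewrite mulmx0 addr0 mul_mx_scalar linearZ /= scalerA mulfV // scale1r.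
- rewrite -defC [(s^-1 *: b)^T]linearZ /= -scalemxAl -scalemxAr scalerA -invfM ss.
  by rewrite addrC subrK.
Qed.

Lemma sym_posdef_unitmx (R : realType) (n : nat) (B : 'M[R]_n) :
  sym_posdef B -> B \in unitmx.
Proof.
by case/sym_posdef_factor=> C unitC ->; rewrite unitmx_mul unitmx_tr unitC.
Qed.

(** * The weighted Frobenius norm *)

Lemma sqnormFB_factor (R : realType) (n : nat) (C X : 'M[R]_n) :
  sqnormFB (C^T *m C) X = \tr ((C *m X *m C^T)^T *m (C *m X *m C^T)).
Proof.
by rewrite /sqnormFB !mulmxA mxtrace_mulC !trmx_mul trmxK !mulmxA.
Qed.

Lemma sqnormFB_ge0 (R : realType) (n : nat) (B X : 'M[R]_n) :
  sym_posdef B -> 0 <= sqnormFB B X.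
Proof.
case/sym_posdef_factor=> C _ ->.
by rewrite sqnormFB_factor mxtrace_trmx_mul_ge0.
Qed.

Lemma sqnormFB_eq0 (R : realType) (n : nat) (B X : 'M[R]_n) :
  sym_posdef B -> sqnormFB B X = 0 -> X = 0.
Proof.
case/sym_posdef_factor=> C unitC ->.
rewrite sqnormFB_factor => /mxtrace_trmx_mul_eq0 CXC0.
have : invmx C *m (C *m X *m C^T) *m invmx C^T = 0.
  by rewrite CXC0 mulmx0 mul0mx.
by rewrite !mulmxA mulVmx // mul1mx mulmxK // unitmx_tr.
Qed.

Lemma sqnormFB_tr (R : realType) (n : nat) (B X : 'M[R]_n) :
  sqnormFB B X^T = sqnormFB B X.
Proof.
by rewrite /sqnormFB trmxK mxtrace_mulC !mulmxA mxtrace_mulC !mulmxA.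
Qed.

Lemma sqnormFBD_orth (R : realType) (n : nat) (B X Y : 'M[R]_n) :
  B^T = B -> \tr (X^T *m B *m Y *m B) = 0 ->
  sqnormFB B (X + Y) = sqnormFB B X + sqnormFB B Y.
Proof.
move=> symB orthXY.
(* The two cross terms agree, by transposition and cyclicity of the trace. *)
have orthYX : \tr (Y^T *m B *m X *m B) = 0.
  by rewrite -orthXY -mxtrace_tr !trmx_mul symB trmxK mxtrace_mulC !mulmxA.
rewrite /sqnormFB [(X + Y)^T]linearD /= !(mulmxDl, mulmxDr) !mxtraceD orthXY orthYX.
by rewrite addr0 add0r.
Qed.

(** After Pythagoras, [r] is the squared distance at the candidate minimizer and [X] the deviation
    from it; this gives optimality, and the next lemma uniqueness. *)
Lemma le_half_sqnormFBD (R : realType) (n : nat) (B X : 'M[R]_n) (r : R) :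
  sym_posdef B -> 2^-1 * r <= 2^-1 * (sqnormFB B X + r).
Proof. by move=> posB; rewrite ler_pM2l ?invr_gt0 // lerDr sqnormFB_ge0. Qed.

Lemma half_sqnormFBD_le (R : realType) (n : nat) (B X : 'M[R]_n) (r : R) :
  sym_posdef B -> 2^-1 * (sqnormFB B X + r) <= 2^-1 * r -> X = 0.
Proof.
move=> posB; rewrite ler_pM2l ?invr_gt0 // gerDr => le0.
by apply: (sqnormFB_eq0 posB); apply/eqP; rewrite eq_le le0 sqnormFB_ge0.
Qed.

(** * The Gram matrix *)

(** Any [K] killed by the Gram matrix on its left is killed by [M], since the Gram form at [M *m K]
    is definite; taking the cokernel for [K] yields the inclusion. *)
Lemma submx_gram (R : realType) (n q : nat) (B : 'M[R]_n) (M : 'M[R]_(n, q)) :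
  sym_posdef B -> (M <= M^T *m invmx B *m M)%MS.
Proof.
move=> posB; have unitB := sym_posdef_unitmx posB.
have [C unitC defB] := sym_posdef_factor posB.
rewrite submxE; set K := cokermx _.
have GK0 : M^T *m invmx B *m M *m K = 0 by rewrite mulmx_coker.
clearbody K.
(* Chosen so that [W^T *m W] is [K^T] times the Gram matrix times [K]. *)
pose W := C *m (invmx B *m (M *m K)).
have W0 : W = 0.
  apply: mxtrace_trmx_mul_eq0.
  rewrite /W !trmx_mul trmx_inv (proj1 posB) -!mulmxA (mulmxA C^T) -defB.
  by rewrite (mulKVmx unitB) !mulmxA -!(mulmxA K^T) GK0 mulmx0 mxtrace0.
have -> : M *m K = B *m (invmx C *m W) by rewrite mulKmx // mulKVmx.
by rewrite W0 !mulmx0.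
Qed.

(** The row space inclusion transposed, the Gram matrix being symmetric. [H] solves the normal
    equations even where the Gram matrix is singular. *)
Lemma gram_factor (R : realType) (n q : nat) (B : 'M[R]_n)
    (M : 'M[R]_(n, q)) :
  sym_posdef B -> exists H : 'M[R]_(q, n),
    M^T = M^T *m invmx B *m M *m H.
Proof.
move=> posB; have /submxP[H defM] := submx_gram M posB.
exists H^T.
by rewrite {1}defM !trmx_mul trmx_inv trmxK (proj1 posB) !mulmxA.
Qed.

Section RowVariant.

Variables (R : realType) (n q : nat) (A B : 'M[R]_n) (S : 'M[R]_(n, q)).
Variables (Xk : 'M[R]_n).
Hypotheses (unitA : A \in unitmx) (posB : sym_posdef B).

Let M := A^T *m S.

Let trM : M^T = S^T *m A. Proof. by rewrite trmx_mul trmxK. Qed.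

(** The weight [B] cancels [invmx B], which leaves the factor [S^T *m A *m Z]. *)
Lemma row_orth (Z : 'M[R]_n) (Y : 'M[R]_(n, q)) :
  S^T *m A *m Z = 0 ->
  \tr ((invmx B *m A^T *m S *m Y^T)^T *m B *m Z *m B) = 0.
Proof.
move=> MZ0; rewrite !trmx_mul !trmxK trmx_inv (proj1 posB) -!mulmxA.
rewrite mulKmx ?sym_posdef_unitmx // (mulmxA A) (mulmxA S^T) (mulmxA S^T) MZ0.
by rewrite mul0mx mulmx0 mxtrace0.
Qed.

Lemma row_solution_exists :
  exists Y : 'M[R]_(n, q),
    S^T *m A *m (Xk + invmx B *m A^T *m S *m Y^T) = S^T.
Proof.
have [H defMT] := gram_factor M posB.
(* The constraint asks that the Gram matrix times [Y^T] be [M^T *m (invmx A - Xk)], so [Y^T] is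
   [H *m (invmx A - Xk)]. *)
exists ((invmx A - Xk)^T *m H^T).
rewrite -trM [X in _ + _ *m X]trmx_mul !trmxK mulmxDr.
have -> : M^T *m (invmx B *m A^T *m S *m (H *m (invmx A - Xk)))
          = M^T *m (invmx A - Xk).
  by rewrite {2}defMT -!mulmxA.
by rewrite mulmxBr addrC subrK trM mulmxK.
Qed.

Lemma row_variant :
  exists Xk1 : 'M[R]_n,
    [/\ forall X : 'M[R]_n,
          is_argmin (fun X' : 'M[R]_n => S^T *m A *m X' = S^T)
                    (fun X' : 'M[R]_n => 2^-1 * sqnormFB B (X' - Xk)) X
          <-> X = Xk1,
        forall X : 'M[R]_n,
          is_argmin_fst
            (fun XY : 'M[R]_n * 'M[R]_(n, q) =>
               XY.1 = Xk + invmx B *m A^T *m S *m XY.2^T)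
            (fun XY : 'M[R]_n * 'M[R]_(n, q) =>
               2^-1 * sqnormFB B (XY.1 - invmx A)) X
          <-> X = Xk1
      & \rank S = q ->
          S^T *m A *m invmx B *m A^T *m S \in unitmx /\
          Xk1 = Xk + invmx B *m A^T *m S
                     *m invmx (S^T *m A *m invmx B *m A^T *m S)
                     *m S^T *m (1%:M - A *m Xk)].
Proof.
have [Y0 feasY0] := row_solution_exists.
pose X0 := Xk + invmx B *m A^T *m S *m Y0^T.
have symB := proj1 posB.
(* [X - X0] is annihilated by [S^T *m A], while [X0 - Xk] has the form
   [invmx B *m A^T *m S *m Y0^T]. *)
have pyth1 X : S^T *m A *m X = S^T ->
    sqnormFB B (X - Xk) = sqnormFB B (X - X0) + sqnormFB B (X0 - Xk).
  move=> feasX; rewrite -(subrKA X0 X) [X - X0 + _]addrC [RHS]addrC.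
  apply: sqnormFBD_orth => //; rewrite {1}/X0 addrC addKr.
  by apply: row_orth; rewrite mulmxBr feasX feasY0 subrr.
(* The roles are exchanged: now [X0 - invmx A] is annihilated, as both terms satisfy the linear
   constraint. *)
have pyth2 X Y : X = Xk + invmx B *m A^T *m S *m Y^T ->
    sqnormFB B (X - invmx A)
    = sqnormFB B (X - X0) + sqnormFB B (X0 - invmx A).
  move=> defX; rewrite -(subrKA X0 X); apply: sqnormFBD_orth => //.
  have -> : X - X0 = invmx B *m A^T *m S *m (Y - Y0)^T.
    by rewrite defX /X0 opprD addrACA subrr add0r [(Y - Y0)^T]linearB mulmxBr.
  by apply: row_orth; rewrite mulmxBr feasY0 mulmxK // subrr.
exists X0; split=> [X|X|rankS].
- split=> [[feasX minX]|->].
    have := minX X0 feasY0; rewrite (pyth1 X) // => /(half_sqnormFBD_le posB).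
    exact: subr0_eq.
  by split=> // X' feasX'; rewrite (pyth1 X') // le_half_sqnormFBD.
- split=> [[Y [/= defX minX]]|->].
    have /= := minX (X0, Y0) erefl; rewrite (pyth2 X Y) //.
    by move/(half_sqnormFBD_le posB)/subr0_eq.
  exists Y0; split=> //= -[X' Y] /= defX'.
  by rewrite (pyth2 X' Y) // le_half_sqnormFBD.
have rankM : \rank M = q by rewrite /M eqmxMfull ?row_full_unit ?unitmx_tr.
have unitG : S^T *m A *m invmx B *m A^T *m S \in unitmx.
  (* The row space of the Gram matrix contains that of [M], which has rank [q]. *)
  have -> : S^T *m A *m invmx B *m A^T *m S = M^T *m invmx B *m M.
    by rewrite trM !mulmxA.
  rewrite -row_full_unit /row_full eqn_leq rank_leq_col -{1}rankM.
  by rewrite mxrankS // submx_gram.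
(* Feasibility of [X0] says that the Gram matrix times [Y0^T] is [S^T *m (1%:M - A *m Xk)];
   inverting it determines [Y0]. *)
split=> //; rewrite /X0; congr (_ + _); rewrite -!(mulmxA (_ *m S)).
congr (_ *m _); rewrite -[LHS](mulKmx unitG) -[RHS]mulmxA; congr (_ *m _).
rewrite mulmxBr mulmx1 -[X in X - _]feasY0 mulmxDr !mulmxA.
by rewrite [RHS]addrC addKr.
Qed.

End RowVariant.

(** * Both variants, the second by transposition *)

Theorem theorem32 (R : realType) (n q : nat) (A B : 'M[R]_n)
    (S : 'M[R]_(n, q)) (Xk : 'M[R]_n)
    (unitA : A \in unitmx) (posB : sym_posdef B) :
  (exists Xk1 : 'M[R]_n,
    [/\ forall X : 'M[R]_n,
          is_argmin (fun X' : 'M[R]_n => S^T *m A *m X' = S^T)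
                    (fun X' : 'M[R]_n => 2^-1 * sqnormFB B (X' - Xk)) X
          <-> X = Xk1,
        forall X : 'M[R]_n,
          is_argmin_fst
            (fun XY : 'M[R]_n * 'M[R]_(n, q) =>
               XY.1 = Xk + invmx B *m A^T *m S *m XY.2^T)
            (fun XY : 'M[R]_n * 'M[R]_(n, q) =>
               2^-1 * sqnormFB B (XY.1 - invmx A)) X
          <-> X = Xk1
      & \rank S = q ->
          S^T *m A *m invmx B *m A^T *m S \in unitmx /\
          Xk1 = Xk + invmx B *m A^T *m S
                     *m invmx (S^T *m A *m invmx B *m A^T *m S)
                     *m S^T *m (1%:M - A *m Xk)])
  /\
  (exists Xk1 : 'M[R]_n,
    [/\ forall X : 'M[R]_n,
          is_argmin (fun X' : 'M[R]_n => X' *m A *m S = S)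
                    (fun X' : 'M[R]_n => 2^-1 * sqnormFB B (X' - Xk)) X
          <-> X = Xk1,
        forall X : 'M[R]_n,
          is_argmin_fst
            (fun XY : 'M[R]_n * 'M[R]_(n, q) =>
               XY.1 = Xk + XY.2 *m S^T *m A^T *m invmx B)
            (fun XY : 'M[R]_n * 'M[R]_(n, q) =>
               2^-1 * sqnormFB B (XY.1 - invmx A)) X
          <-> X = Xk1
      & \rank S = q ->
          S^T *m A^T *m invmx B *m A *m S \in unitmx /\
          Xk1 = Xk + (1%:M - Xk *m A) *m S
                     *m invmx (S^T *m A^T *m invmx B *m A *m S)
                     *m S^T *m A^T *m invmx B]).
Proof.
split; first exact: row_variant.
have unitAT : A^T \in unitmx by rewrite unitmx_tr.
have symB := proj1 posB.
have [X1 [argmin1 argmin2 formula]] := row_variant S Xk^T unitAT posB.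
have trfeas1 X : S^T *m A^T *m X^T = S^T <-> X *m A *m S = S.
  rewrite -mulmxA -!trmx_mul.
  by split=> [/trmx_inj //|->].
(* Only [X] is transposed: the same [Y] serves both problems. *)
have trfeas2 X (Y : 'M[R]_(n, q)) :
    X^T = Xk^T + invmx B *m A^T^T *m S *m Y^T
    <-> X = Xk + Y *m S^T *m A^T *m invmx B.
  have -> : Xk^T + invmx B *m A^T^T *m S *m Y^T
            = (Xk + Y *m S^T *m A^T *m invmx B)^T.
    by rewrite linearD /= !trmx_mul !trmxK trmx_inv symB !mulmxA.
  by split=> [/trmx_inj //|->].
(* Transposition is an isometry for the weighted norm, so it carries minimizers to minimizers. *)
have trobj X Z : sqnormFB B (X^T - Z^T) = sqnormFB B (X - Z).
  by rewrite -linearB sqnormFB_tr.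
exists X1^T; split=> [X|X|rankS].
- have -> : X = X1^T <-> X^T = X1 by split=> [->|<-]; rewrite trmxK.
  rewrite -argmin1; split=> -[feasX minX]; split; try exact/trfeas1.
    by move=> Z feasZ; rewrite -[Z]trmxK !trobj minX // -trfeas1 trmxK.
  by move=> Z feasZ; rewrite -(trobj X) -(trobj Z) minX // trfeas1.
- have -> : X = X1^T <-> X^T = X1 by split=> [->|<-]; rewrite trmxK.
  rewrite -argmin2; split=> -[Y [/= feasX minX]]; exists Y.
    split=> [|[Z W]] /=; first exact/trfeas2.
    rewrite -[Z]trmxK => /trfeas2 feasZ; rewrite -trmx_inv !trobj.
    exact: (minX (Z^T, W)).
  split=> [|[Z W]] /=; first exact/trfeas2.
  move=> /trfeas2 feasZ; rewrite -(trobj X) -(trobj Z) trmx_inv.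
  exact: (minX (Z^T, W)).
have [unitG ->] := formula rankS; rewrite trmxK in unitG *; split=> //.
rewrite linearD /= !trmx_mul trmxK trmx_inv linearB /= !trmx_mul !trmxK trmx1.
by rewrite trmx_inv symB !mulmxA.
Qed.
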